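(* Let $A\colon\mathcal{X}\to 2^{\mathcal{X}^*}$, let $W\colon\mathcal{X}\to 2^{\mathcal{X}^*}$, let $u^*\in\mathcal{X}^*$, and let $\gamma\in\,]0,+\infty[$. Suppose that $x\in\operatorname{dom}W$ and that $z\in J_{\gamma(A-u^* )}^Wx$. Then the following hold: (i) There exist $x^*\in Wx$ and $z^*\in Wz$ such that $H_A(x,u^* )\geq\langle x-z,x^*-z^*\rangle/\gamma$. (ii) Suppose that $W$ is $\phi$-uniformly monotone. Then $H_A(x,u^* )\geq\phi(\|x-z\|)/\gamma$. (iii) Suppose that $W$ is $\alpha$-strongly monotone. Then $H_A(x,u^* )\geq\alpha\|x-z\|^2/\gamma$. (iv) Suppose that $W$ is at most single-valued. Then $H_A(x,u^* )\geq\langle x-z,Wx-Wz\rangle/\gamma$. (v) Let $f\in\Gamma_0(\mathcal{X})$ be Gateaux differentiable on $\operatorname{dom}\nabla f=\operatorname{int\,dom}f$ and suppose that $W=\nabla f$. Then $$H_A(x,u^* )\geq\frac{D_f(x,z)+D_f(z,x)}{\gamma}.$$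
   Context: $\mathcal{X}\neq\{0\}$ is a reflexive real Banach space with topological dual $\mathcal{X}^*$, and $\langle\cdot,\cdot\rangle$ is the canonical duality pairing. For $A\colon\mathcal{X}\to 2^{\mathcal{X}^*}$: $\operatorname{gra}A=\{(x,x^* )\mid x^*\in Ax\}$, $\operatorname{dom}A=\{x\mid Ax\neq\varnothing\}$, $A^{-1}x^*=\{x\mid x^*\in Ax\}$; images of sets and compositions are unions of images. The Haraux function of $A$ is $H_A\colon\mathcal{X}\times\mathcal{X}^*\to[-\infty,+\infty]\colon(x,u^* )\mapsto\sup_{(y,y^* )\in\operatorname{gra}A}\langle x-y,y^*-u^*\rangle$. For $u^*\in\mathcal{X}^*$ and $\gamma>0$, $\gamma(A-u^* )$ is the operator $x\mapsto\{\gamma(x^*-u^* )\mid x^*\in Ax\}$. The warped resolvent of $A$ with kernel $K\colon\mathcal{X}\to2^{\mathcal{X}^*}$ is $J_A^K=(K+A)^{-1}\circ K$. For an increasing function $\phi\colon[0,+\infty[\,\to[0,+\infty]$ vanishing only at $0$, $W$ is $\phi$-uniformly monotone if $\langle x-y,x^*-y^*\rangle\geq\phi(\|x-y\|)$ for all $(x,x^* ),(y,y^* )\in\operatorname{gra}W$; it is $\alpha$-strongly monotone, $\alpha\in\,]0,+\infty[$, if this holds with $\phi=\alpha|\cdot|^2$. $W$ is at most single-valued if each $Wx$ has at most one element, in which case $Wx$ also denotes that element for $x\in\operatorname{dom}W$. $\Gamma_0(\mathcal{X})$ is the class of proper lower semicontinuous convex functions from $\mathcal{X}$ to $]-\infty,+\infty]$.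 If $f\in\Gamma_0(\mathcal{X})$ is Gateaux differentiable on $\operatorname{int\,dom}f\neq\varnothing$, the Bregman distance is $D_f\colon\mathcal{X}\times\mathcal{X}\to[0,+\infty]$, $D_f(x,y)=f(x)-f(y)-\langle x-y,\nabla f(y)\rangle$ if $y\in\operatorname{int\,dom}f$, and $D_f(x,y)=+\infty$ otherwise. *)

(* Defs.v *)
From HB Require Import structures.
From mathcomp Require Import all_boot all_order all_algebra.
From mathcomp Require Import all_classical all_reals all_analysis.

Set Implicit Arguments.
Unset Strict Implicit.
Unset Printing Implicit Defensive.
Import Order.TTheory GRing.Theory Num.Theory.
Import numFieldNormedType.Exports.
Local Open Scope classical_set_scope.
Local Open Scope ring_scope.

Section Dual.
Context {R : realType} (X : normedModType R).

Definition dual_pred : {pred X -> R^o} :=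
  fun f => `[< linear f /\ continuous f >].

Lemma dual_submod_closed : submod_closed dual_pred.
Proof.
split; first by apply/asboolP; split=> [a u v|]; [rewrite scaler0 addr0|exact: cst_continuous].
move=> a f g /asboolP[lf cf] /asboolP[lg cg]; apply/asboolP; split=> [b u v|x].
  rewrite !fctE lf lg !scalerDr !scalerA mulrC -!addrA; congr (_ + _).
  by rewrite addrCA.
by apply: cvgD; [apply: cvgZr; exact: cf|exact: cg].
Qed.

HB.instance Definition _ :=
  GRing.isSubmodClosed.Build R (X -> R^o) dual_pred dual_submod_closed.

(** The topological dual of [X]. *)
Record dual := Dual { dual_fun :> X -> R^o; dual_proof : dual_fun \in dual_pred }.

HB.instance Definition _ := [isSub for dual_fun].
HB.instance Definition _ := [Choice of dual by <:].
HB.instance Definition _ := [SubChoice_isSubLmodule of dual by <:].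

Lemma dual_linear (f : dual) : linear f.
Proof. by have /asboolP[] := dual_proof f. Qed.

Lemma dual_continuous (f : dual) : continuous f.
Proof. by have /asboolP[] := dual_proof f. Qed.

HB.instance Definition _ (f : dual) :=
  GRing.isLinear.Build R X R^o *:%R f (@dual_linear f).

Definition dual_norm (f : dual) : R := sup [set `|f x| | x in [set x | `|x| <= 1]].

Lemma dual_norm_has_sup (f : dual) :
  has_sup [set `|f x| | x in [set x | `|x| <= 1]].
Proof.
split; first by exists `|f 0|, 0 => //=; rewrite normr0.
have /linear_bounded_continuous/bounded_funP/(_ 1)[M fM] := @dual_continuous f.
by exists M => _ [x /= x1 <-]; exact: fM.
Qed.

Lemma dual_norm_ub (f : dual) x : `|x| <= 1 -> `|f x| <= dual_norm f.
Proof.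
by move=> x1; apply: ub_le_sup; [have [] := dual_norm_has_sup f|exists x].
Qed.

Lemma dual_norm_le (f : dual) c :
  (forall x, `|x| <= 1 -> `|f x| <= c) -> dual_norm f <= c.
Proof.
by move=> fc; apply: ge_sup => [|_ [x x1 <-]];
  [have [] := dual_norm_has_sup f|exact: fc].
Qed.

Lemma dual_normD f g : dual_norm (f + g) <= dual_norm f + dual_norm g.
Proof.
apply: dual_norm_le => x x1; apply: le_trans (ler_normD _ _) _.
by apply: lerD; exact: dual_norm_ub.
Qed.

Lemma dual_normZ_le a f : dual_norm (a *: f) <= `|a| * dual_norm f.
Proof.
apply: dual_norm_le => x x1; rewrite [(a *: f) x]/(a * f x) normrM.
by apply: ler_wpM2l => //; exact: dual_norm_ub.
Qed.

Lemma dual_normZ a f : dual_norm (a *: f) = `|a| * dual_norm f.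
Proof.
apply/eqP; rewrite eq_le dual_normZ_le/=.
have [->|a0] := eqVneq a 0.
  rewrite normr0 mul0r; apply: le_trans (normr_ge0 ((0 *: f) 0)) _.
  by apply: dual_norm_ub; rewrite normr0.
rewrite -ler_pdivlMl ?normr_gt0// -normfV.
by rewrite -[in leLHS](scalerK a0 f) dual_normZ_le.
Qed.

Lemma dual_norm_eq0 f : dual_norm f = 0 -> f = 0.
Proof.
move=> f0; apply/val_inj/funext => x /=.
have [->|x0] := eqVneq x 0; first by rewrite linear0.
have : `|f (`|x|^-1 *: x)| <= 0.
  by rewrite -f0 dual_norm_ub// normrZ normfV normr_id mulVf ?normr_eq0.
rewrite normr_le0 linearZ/= scaler_eq0 invr_eq0 normr_eq0 (negbTE x0)/=.
by move/eqP.
Qed.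

HB.instance Definition _ :=
  Lmodule_isNormed.Build R dual dual_normD dual_normZ dual_norm_eq0.

Definition pairing (x : X) (u : dual) : R := u x.

End Dual.
Arguments dual {R} X.

(** Every element of the bidual is the evaluation at some point of [X]. *)
Definition reflexive_space (R : realType) (X : normedModType R) : Prop :=
  forall F : dual (dual X), exists x : X, forall u : dual X, F u = pairing x u.

Section Operators.
Context {S T U : Type}.

Definition gra (A : S -> set T) : set (S * T) := [set p | A p.1 p.2].
Definition dom (A : S -> set T) : set S := [set x | A x !=set0].
Definition op_inv (A : S -> set T) : T -> set S := fun y => [set x | A x y].
Definition op_comp (B : T -> set U) (A : S -> set T) : S -> set U :=
  fun x => \bigcup_(y in A x) B y.
Definition at_most_single_valued (A : S -> set T) : Prop :=
  forall x y y', A x y -> A x y' -> y = y'.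

End Operators.

Section Monotone.
Context {R : realType} {X : normedModType R}.
Implicit Types (A K W : X -> set (dual X)) (x y z : X) (u : dual X).

Definition op_add K A : X -> set (dual X) :=
  fun x => [set k + a | k in K x & a in A x].

(** The operator [gamma (A - u)]. *)
Definition op_shift_scale (gamma : R) A u : X -> set (dual X) :=
  fun x => [set gamma *: (a - u) | a in A x].

Definition warped_resolvent K A : X -> set X :=
  op_comp (op_inv (op_add K A)) K.

(** The element of [W x], meaningful when [W] is at most single-valued and [x]
    is in its domain; the value is 0 if [W x] is empty. *)
Definition op_val W x : dual X := xget 0 (W x).

Definition haraux A x u : \bar R :=
  ereal_sup [set (pairing (x - p.1) (p.2 - u))%:E | p in gra A].

(** Nondecreasing functions from [0, +oo[ to [0, +oo] vanishing only at 0; the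
    values at negative reals are irrelevant. *)
Definition modulus (phi : R -> \bar R) : Prop :=
  [/\ forall s t : R, 0 <= s -> s <= t -> (phi s <= phi t)%E,
      forall t : R, 0 <= t -> (0 <= phi t)%E &
      forall t : R, 0 <= t -> (phi t = 0%E <-> t = 0)].

Definition uniformly_monotone (phi : R -> \bar R) W : Prop :=
  forall p q, gra W p -> gra W q ->
    (phi `|p.1 - q.1|%R <= (pairing (p.1 - q.1) (p.2 - q.2))%:E)%E.

Definition strongly_monotone (alpha : R) W : Prop :=
  uniformly_monotone (fun t => (alpha * `|t| ^+ 2)%:E) W.

End Monotone.

Section Bregman.
Context {R : realType} {X : normedModType R}.
Implicit Types (f : X -> \bar R) (x y v : X) (g : dual X).

Definition edom f : set X := [set x | (f x < +oo)%E].

Definition proper f : Prop :=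
  (forall x, f x != -oo%E) /\ exists x, f x != +oo%E.

(** The right-hand side is well defined when [f] does not take the value
    [-oo]. *)
Definition convex_efun f : Prop :=
  forall x y (t : R), 0 < t -> t < 1 ->
    (f (t *: x + (1 - t) *: y)%R <= t%:E * f x + (1 - t)%:E * f y)%E.

Definition Gamma0 f : Prop :=
  [/\ proper f, lower_semicontinuous f & convex_efun f].

(** [g] is the Gateaux gradient of [f] at [x]. As [g] is linear, the one-sided
    limits along all directions yield the two-sided ones. *)
Definition is_gateaux_gradient f x g : Prop :=
  f x \is a fin_num /\
  forall v, ((f (x + t *: v)%R - f x) / t%:E)%E @[t --> 0^'+] --> (pairing v g)%:E.

(** The gradient of [f] as a set-valued operator; its domain is the set of
    points at which [f] is Gateaux differentiable. *)
Definition grad f : X -> set (dual X) := fun x => [set g | is_gateaux_gradient f x g].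

Definition bregman f x y : \bar R :=
  if `[< (edom f)° y >] then (f x - f y - (pairing (x - y) (op_val (grad f) y))%:E)%E
  else +oo%E.

End Bregman.

(* Main.v *)
Require Import Defs.
From HB Require Import structures.
From mathcomp Require Import all_boot all_order all_algebra.
From mathcomp Require Import all_classical all_reals all_analysis.
From mathcomp Require Import ring.

(** Membership of [z] in the warped resolvent at [x] supplies [xs] in [W x],
    [zs] in [W z] and [as] in [A z] with [xs = zs + gamma (as - u)]. Hence
    [(z, as)] is a point of the graph of [A] at which the quantity whose supremum
    is the Haraux function equals [<x - z, xs - zs> / gamma], as
    [warped_resolvent_haraux] records.

    The other bounds come from what the class of [W] says about
    [<x - z, xs - zs>]: uniform (in particular strong) monotonicity bounds it
    below by [phi |x - z|], and for an at most single-valued [W] it is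
    [<x - z, W x - W z>]. A Gateaux gradient is at most single-valued
    ([grad_single_valued]), and when [f] is finite at both points its values
    cancel in [D_f(x,z) + D_f(z,x)], which leaves exactly
    [<x - z, grad f x - grad f z>] ([bregman_sym]). *)

Import Order.TTheory GRing.Theory Num.Theory.
Import numFieldNormedType.Exports.
Local Open Scope classical_set_scope.
Local Open Scope ring_scope.

Lemma pairingZr {R : realType} {X : normedModType R} (v : X) (c : R) (g : dual X) :
  pairing v (c *: g) = c * pairing v g.
Proof. by []. Qed.

Lemma pairingBr {R : realType} {X : normedModType R} (v : X) (g h : dual X) :
  pairing v (g - h) = pairing v g - pairing v h.
Proof. by []. Qed.

Lemma pairingNl {R : realType} {X : normedModType R} (v : X) (g : dual X) :
  pairing (- v) g = - pairing v g.
Proof. exact: linearN. Qed.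

Lemma op_val_eq {R : realType} {X : normedModType R} {W : X -> set (dual X)}
    {x : X} {g : dual X} :
  at_most_single_valued W -> W x g -> op_val W x = g.
Proof.
move=> Wsingle Wxg; apply: (Wsingle x) => //.
exact: (xgetPex 0 (ex_intro _ g Wxg)).
Qed.

(** The resolvent inclusion identifies [(xs - zs) / gamma] with [as - u] for
    some [as] in [A z], so testing the supremum at [(z, as)] is enough. *)
Lemma warped_resolvent_haraux {R : realType} {X : normedModType R}
    {A W : X -> set (dual X)} {u : dual X} {gamma : R} {x z : X} :
  0 < gamma -> warped_resolvent W (op_shift_scale gamma A u) x z ->
  exists xs zs : dual X, [/\ W x xs, W z zs &
    ((pairing (x - z) (xs - zs) / gamma)%:E <= haraux A x u)%E].
Proof.
move=> gamma_gt0 [xs Wxs [zs Wzs [_ [as_ Aas <-] def_xs]]].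
exists xs, zs; split=> //.
rewrite -def_xs addrAC subrr add0r pairingZr mulrAC mulfV ?gt_eqF// mul1r.
by apply: ereal_sup_ubound; exists (z, as_).
Qed.

(** A linear form is determined by its values, and these are limits in the
    Hausdorff space of extended reals. *)
Lemma grad_single_valued {R : realType} {X : normedModType R} (f : X -> \bar R) :
  at_most_single_valued (grad f).
Proof.
move=> x g h [_ dg] [_ dh]; apply/val_inj/funext => v.
apply: EFin_inj; exact: cvg_unique (dg v) (dh v).
Qed.

(** A function is finite wherever it has a Gateaux gradient, which is what lets
    the values [f x] and [f z] cancel. *)
Lemma bregman_sym {R : realType} {X : normedModType R} {f : X -> \bar R}
    {x z : X} {g h : dual X} :
  (edom f)° x -> (edom f)° z -> grad f x g -> grad f z h ->
  (bregman f x z + bregman f z x)%E = (pairing (x - z) (g - h))%:E.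
Proof.
move=> intx intz fxg fzh; rewrite /bregman !asboolT//.
rewrite (op_val_eq (@grad_single_valued _ _ f) fxg).
rewrite (op_val_eq (@grad_single_valued _ _ f) fzh).
have [fx_fin _] := fxg; have [fz_fin _] := fzh.
rewrite -(fineK fx_fin) -(fineK fz_fin) -(opprB x z) pairingNl pairingBr -!EFinB -EFinD; congr EFin; ring.
Qed.

Theorem proposition5p3 (R : realType) (X : completeNormedModType R)
    (X_neq0 : exists v : X, v != 0) (X_refl : reflexive_space X)
    (A W : X -> set (dual X)) (u : dual X) (gamma : R) (gamma_gt0 : 0 < gamma)
    (x z : X) (xW : dom W x)
    (zJ : warped_resolvent W (op_shift_scale gamma A u) x z) :
  (exists xs zs : dual X, [/\ W x xs, W z zs &
    (haraux A x u >= (pairing (x - z) (xs - zs) / gamma)%:E)%E]) /\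
  (forall phi : R -> \bar R, modulus phi -> uniformly_monotone phi W ->
    (haraux A x u >= phi `|x - z|%R / gamma%:E)%E) /\
  (forall alpha : R, 0 < alpha -> strongly_monotone alpha W ->
    (haraux A x u >= (alpha * `|x - z| ^+ 2 / gamma)%:E)%E) /\
  (at_most_single_valued W ->
    dom W z /\
    (haraux A x u >=
      (pairing (x - z) (op_val W x - op_val W z) / gamma)%:E)%E) /\
  (forall f : X -> \bar R, Gamma0 f -> (edom f)° !=set0 ->
    dom (grad f) = (edom f)° -> W = grad f ->
    (haraux A x u >= (bregman f x z + bregman f z x) / gamma%:E)%E).
Proof.
have [xs [zs [Wx Wz Hle]]] := warped_resolvent_haraux gamma_gt0 zJ.
have inv_gamma : (gamma%:E^-1)%E = (gamma^-1)%:E by rewrite inver gt_eqF.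
have unif (phi : R -> \bar R) : uniformly_monotone phi W ->
    (phi `|x - z|%R / gamma%:E <= haraux A x u)%E.
  move=> /(_ (x, xs) (z, zs) Wx Wz)/= phi_le; apply: le_trans Hle.
  by rewrite inv_gamma EFinM; apply: lee_wpmul2r => //; rewrite lee_fin invr_ge0 ltW.
split; first by exists xs, zs.
split; first by move=> phi _; exact: unif.
split.
  by move=> alpha _ /unif; rewrite inv_gamma -EFinM normr_id.
split.
  move=> Wsingle; split; first by exists zs.
  by rewrite (op_val_eq Wsingle Wx) (op_val_eq Wsingle Wz).
move=> f _ _ dom_grad WE; rewrite WE in Wx Wz.
have intx : (edom f)° x by rewrite -dom_grad; exists xs.
have intz : (edom f)° z by rewrite -dom_grad; exists zs.
by rewrite (bregman_sym intx intz Wx Wz) inv_gamma -EFinM.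
Qed.
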